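(* There exists an ultrafilter $\mathcal{U}\subseteq 2^\omega$ on $\omega$ that is not a $\mathrm{P}$-point and is not completely Baire.
   Context: Every subset of $\omega$ is identified with its characteristic function, so an ultrafilter on $\omega$ is regarded as a subset of the Cantor set $2^\omega$ and carries the subspace topology. For $x,y\subseteq\omega$, $x\subseteq^\ast y$ means that $x\setminus y$ is finite; a pseudointersection of $\mathcal{C}\subseteq\mathcal{P}(\omega)$ is a set $x\subseteq\omega$ such that $x\subseteq^\ast y$ for all $y\in\mathcal{C}$. A $\mathrm{P}$-point is a non-principal ultrafilter $\mathcal{U}$ such that every countable $\mathcal{C}\subseteq\mathcal{U}$ has a pseudointersection in $\mathcal{U}$. A (separable metrizable) space $X$ is completely Baire if every closed subspace of $X$ is a Baire space. *)

(* Defs.v *)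
From mathcomp Require Import all_boot all_classical.
From mathcomp Require Import topology cantor.

Set Implicit Arguments.
Unset Strict Implicit.
Unset Printing Implicit Defensive.

Local Open Scope classical_set_scope.

Definition almost_subset (x y : set nat) : Prop := finite_set (x `\` y).

Definition pseudointersection (C : set_system nat) (x : set nat) : Prop :=
  forall y, C y -> almost_subset x y.

Definition nonprincipal (U : set_system nat) : Prop :=
  forall n, U <> principal_filter n.

Definition P_point (U : set_system nat) : Prop :=
  [/\ UltraFilter U,
      nonprincipal U &
      forall C : set_system nat, C `<=` U -> countable C ->
        exists2 x, U x & pseudointersection C x].

Definition char_fun (x : set nat) : cantor_space := fun n => `[< x n >].

Definition in_cantor (U : set_system nat) : set cantor_space := char_fun @` U.

Definition baire_space (T : topologicalType) : Prop :=
  forall F : nat -> set T,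
    (forall i, open (F i) /\ dense (F i)) -> dense (\bigcap_i F i).

(* A subset viewed as a type, [set_type C], carries the subspace (initial)
   topology; this is not the type [subspace C], in which points outside of [C]
   become isolated. *)
Definition completely_baire (T : topologicalType) : Prop :=
  forall C : set T, closed C -> baire_space (set_type C).

(* Main.v *)
Require Import Defs.
From mathcomp Require Import all_boot all_classical.
From mathcomp Require Import topology cantor.

(** Partition [nat], up to a remainder, into infinite columns indexed by [nat],
    and let [U] be an ultrafilter extending the Fubini square of the Frechet
    filter: the sets that contain almost all points of almost all columns.
    All tails (everything outside of finitely many columns) belong to [U],
    whereas a set meeting every column in a finite set does not, since its
    complement is in the Fubini square.

    [U] is not a P-point, because a pseudointersection of the tails meets every
    column in a finite set ([ultrafilter_fubini_not_P_point]).

    [U] is not completely Baire, because of the sets that meet column [i] in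
    an initial segment of length [f i], for a nondecreasing
    [f : nat -> nat + {oo}].  They form a closed subset of the Cantor space.
    Monotonicity of [f] decides membership in [U]: if [f] reaches [oo], it
    stays there, and the set is in the Fubini square; otherwise all the columns
    of the set are finite.  Up to the remainder, the trace of this closed set
    on [U] is thus the countable crowded space of those [f] that reach [oo], a
    copy of the rationals.  On this trace the open conditions [f n < oo] have
    empty intersection, and each of them is dense: truncating the columns up to
    [n] at height [N] preserves monotonicity and, as finitely many columns are
    negligible, membership in [U], and the truncations converge to the given
    set when [N] grows.  So the trace is not Baire
    ([ultrafilter_fubini_not_completely_baire]). *)

Set Implicit Arguments.
Unset Strict Implicit.
Unset Printing Implicit Defensive.

Local Open Scope classical_set_scope.

(** * Failure of complete Baireness for a subspace *)

(** The Baire property of the closed subspace [A `&` K] of [A], read in the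
    ambient space, so that no iterated subtype has to be handled afterwards. *)
Lemma not_completely_baire_set_type (T : topologicalType) (A K : set T)
    (G : nat -> set T) :
  closed K -> A `&` K !=set0 ->
  (forall n, open (G n)) ->
  (forall n, A `&` K `<=` closure (A `&` K `&` G n)) ->
  A `&` K `&` \bigcap_n G n = set0 ->
  ~ completely_baire (set_type A).
Proof.
move=> clK [a [Aa Ka]] oG dG G0 cbA.
have val_cont (S : topologicalType) (B : set S) :
    continuous (set_val : set_type B -> S) by exact: initial_continuous.
pose C : set (set_type A) := set_val @^-1` K.
have clC : closed C by apply: preimage_closed => // x _; exact: val_cont.
pose F n : set (set_type C) := set_val @^-1` (set_val @^-1` G n).
have inF (x : T) (Ax : A x) (Kx : K x) :
    exists z : set_type C, set_val (set_val z) = x.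
  have Cx : C (SigSub (mem_set Ax)) by [].
  by exists (SigSub (mem_set Cx)).
have FP n : open (F n) /\ dense (F n).
  split; first by apply: open_comp => [x _|]; [exact: val_cont|
    apply: open_comp => [x _|]; [exact: val_cont|exact: oG]].
  move=> O [z Oz] [_ [O' oO' <-] OE].
  have zAK : (A `&` K) (set_val (set_val z)).
    by split; [exact: set_valP (set_val z)|exact: set_valP z].
  have := dG n _ zAK O'; case.
    by apply: open_nbhs_nbhs; split => //; move: Oz; rewrite -OE.
  move=> x [[[Ax Kx] Gx] O'x].
  have [w wx] := inF x Ax Kx.
  by exists w; split; [rewrite -OE /= wx|rewrite /F /= wx].
have [z za] := inF a Aa Ka.
have [w [_ Fw]] := cbA C clC F FP setT (ex_intro _ z I) openT.
have : (A `&` K `&` \bigcap_n G n) (set_val (set_val w)).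
  split; last by move=> n _; exact: (Fw n I).
  by split; [exact: set_valP (set_val w)|exact: set_valP w].
by rewrite G0.
Qed.

(** * Coordinates in the Cantor space *)

Lemma cantor_coord_continuous (k : nat) :
  continuous (fun g : cantor_space => g k).
Proof. exact: (@proj_continuous nat (fun=> bool) k). Qed.

Lemma open_cantor_coord (k : nat) (b : bool) :
  open [set g : cantor_space | g k = b].
Proof.
apply: (@open_comp _ _ (fun g : cantor_space => g k) [set b]).
  by move=> g _; exact: cantor_coord_continuous.
exact: discrete_open.
Qed.

Lemma closed_cantor_coord (k : nat) (b : bool) :
  closed [set g : cantor_space | g k = b].
Proof.
rewrite (_ : mkset _ = ~` [set g : cantor_space | g k = ~~ b]).
  by apply: open_closedC; exact: open_cantor_coord.
by apply/seteqP; split => g /=; case: (g k); case: b.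
Qed.

Lemma cantor_cvg (f : nat -> cantor_space) (g : cantor_space) :
  (forall k, \forall N \near \oo, f N k = g k) -> f @ \oo --> g.
Proof.
move=> fg; apply/pointwise_cvgP => k B Bg.
by apply: filterS (fg k) => N /= ->; exact: nbhs_singleton.
Qed.

(** * The Fubini square of the Frechet filter *)

(** The [j]-th point of column [i].  The columns are disjoint but need not cover
    [nat], as membership in [fubini] ignores the remainder. *)
Definition cell (i j : nat) : nat := pickle (i, j).

Lemma cell_inj i j i' j' : cell i j = cell i' j' -> i = i' /\ j = j'.
Proof. by move=> /(pcan_inj pickleK)[]. Qed.

Definition fubini : set_system nat :=
  [set X | \forall i \near \oo, \forall j \near \oo, X (cell i j)].

Lemma fubini_filter : ProperFilter fubini.
Proof.
split; first by case=> n _ /(_ n (leqnn n)) [m _] /(_ m (leqnn m)).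
split.
- by apply: nearW => i; exact: nearW.
- by move=> X Y; apply: (@filterS2 nat \oo) => i; exact: filterS2.
- by move=> X Y XY; apply: (@filterS _ \oo) => i; apply: filterS => j; exact: XY.
Qed.

Definition tail (n : nat) : set nat :=
  [set k | forall i j, k = cell i j -> n < i].

Lemma fubini_tail n : fubini (tail n).
Proof.
apply: filterS (nbhs_infty_gt n) => i ni; apply: nearW => j i' j'.
by move=> /cell_inj[<-].
Qed.

(** The complement of [x] would be in the Fubini square. *)
Lemma ultrafilter_no_finite_columns (U : set_system nat) (x : set nat) :
  UltraFilter U -> fubini `<=` U ->
  U x -> ~ (forall i, \forall j \near \oo, ~ x (cell i j)).
Proof.
move=> UU FU Ux xfin; apply: (@filter_not_empty _ U _).
have Ucx : U (~` x) by apply: FU; apply: nearW.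
by rewrite -(setICr x); exact: filterI.
Qed.

(** A pseudointersection [x] of the tails has finite columns, as its column [i]
    lies in the finite set [x `\` tail i]. *)
Lemma ultrafilter_fubini_not_P_point (U : set_system nat) :
  UltraFilter U -> fubini `<=` U -> ~ P_point U.
Proof.
move=> UU FU [_ _ /(_ (range tail))]; case.
- by move=> _ [n _ <-]; apply: FU; exact: fubini_tail.
- exact: sub_countable (card_image_le _ _) _.
move=> x Ux xtail.
apply: (ultrafilter_no_finite_columns UU FU Ux) => i.
have fin : finite_set [set j | x (cell i j)].
  apply: (@sub_finite_set _ _ (cell i @^-1` (x `\` tail i))).
    by move=> j xij; split => // /(_ i j erefl); rewrite ltnn.
  apply: finite_preimage; last by apply: xtail; exists i.
  by move=> j j' _ _ /cell_inj[].
have /finite_seqP[s sE] := fin.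
exists (\max_(j <- s) j).+1 => // j /= smax xij.
have : j \in s by have : [set` s] j by rewrite -sE.
by move=> js; move: smax; rewrite leqNgt ltnS (leq_bigmax_seq _ js).
Qed.

(** * A closed set whose trace on the ultrafilter is not Baire *)

(** The sets that meet column [i] in an initial segment of length [f i], with
    [f] nondecreasing and possibly infinite. *)
Definition staircase : set cantor_space :=
  [set g | forall i i' j j', i <= i' -> j' <= j ->
    g (cell i j) -> g (cell i' j')].

(** Each instance of the defining implication concerns two coordinates only. *)
Lemma closed_staircase : closed staircase.
Proof.
rewrite (_ : staircase =
  \bigcap_(q in [set q : (nat * nat) * (nat * nat) |
                  q.1.1 <= q.2.1 /\ q.2.2 <= q.1.2])
    ([set g : cantor_space | g (cell q.1.1 q.1.2) = false] `|`
     [set g : cantor_space | g (cell q.2.1 q.2.2) = true])).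
  by apply: closed_bigI => q _; apply: closedU; exact: closed_cantor_coord.
apply/seteqP; split=> g gP.
  move=> [[i j] [i' j']] /= [ii' jj'].
  by case gij: (g (cell i j)); [right; exact: gP gij|left].
move=> i i' j j' ii' jj' gij.
by have [/=|//] := gP ((i, j), (i', j')) (conj ii' jj'); rewrite gij.
Qed.

(** On a staircase, the open condition [f n < oo]. *)
Definition short_column (n : nat) : set cantor_space :=
  \bigcup_j [set g : cantor_space | g (cell n j) = false].

Definition truncate (n N : nat) (x : set nat) : set nat :=
  [set k | x k /\ forall i j, k = cell i j -> i <= n -> j < N].

Lemma truncate_cvg n x : char_fun (truncate n N x) @[N --> \oo] --> char_fun x.
Proof.
apply: cantor_cvg => k.
(* [N] has to exceed the height of [k] in its column, if it lies in one *)
apply: filterS (nbhs_infty_gt (odflt (0, 0) (unpickle k)).2) => N kN.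
apply: asbool_equiv_eq; split=> [[]//|xk]; split=> // i j kE _.
by move: kN; rewrite kE /cell pickleK.
Qed.

(** Heights become [minn N (f i)] for [i <= n] and stay [f i] beyond, which is
    again nondecreasing. *)
Lemma truncate_staircase n N x :
  staircase (char_fun x) -> staircase (char_fun (truncate n N x)).
Proof.
move=> sx i i' j j' ii' jj' /asboolP[xij hij]; apply/asboolP; split.
  by apply/asboolP; apply: sx ii' jj' _; exact/asboolP.
move=> a b /cell_inj[<- <-] i'n; apply: leq_ltn_trans jj' _.
exact: hij erefl (leq_trans ii' i'n).
Qed.

(** Truncation only affects the columns up to [n], which miss [tail n]. *)
Lemma ultrafilter_truncate (U : set_system nat) n N x :
  UltraFilter U -> fubini `<=` U -> U x -> U (truncate n N x).
Proof.
move=> UU FU Ux; apply: filterS (filterI Ux (FU _ (fubini_tail n))) => k [xk].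
by move=> tk; split=> // i j /tk; rewrite ltnNge => /negbTE ->.
Qed.

(** A staircase in every [short_column n] would have finite columns only, hence lie
    outside of [U]; so these relatively open dense sets contradict the Baire
    property of the trace of [staircase]. *)
Lemma ultrafilter_fubini_not_completely_baire (U : set_system nat) :
  UltraFilter U -> fubini `<=` U ->
  ~ completely_baire (set_type (in_cantor U)).
Proof.
move=> UU FU.
apply: (@not_completely_baire_set_type _ _ staircase short_column).
- exact: closed_staircase.
- exists (char_fun setT); split; first by exists setT => //; exact: filterT.
  by move=> *; apply/asboolP.
- by move=> n; apply: bigcup_open => j _; exact: open_cantor_coord.
- move=> n _ [[x Ux <-] sx] B /(truncate_cvg n) [N _ /(_ N (leqnn N)) BN].
  exists (char_fun (truncate n N x)); split=> //; split; first split.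
  + by exists (truncate n N x) => //; exact: ultrafilter_truncate.
  + exact: truncate_staircase.
  + by exists N => //; apply/asboolPn => -[_ /(_ n N erefl (leqnn n))];
      rewrite ltnn.
- apply/seteqP; split=> // _ [[[x Ux <-] sx] short].
  apply: (ultrafilter_no_finite_columns UU FU Ux) => i.
  have [j _ /asboolPn nxij] := short i I.
  apply: filterS (nbhs_infty_ge j) => j' jj' xij'; apply: nxij.
  by apply/asboolP; apply: sx (leqnn i) jj' _; exact/asboolP.
Qed.

Theorem theorem39 :
  exists U : set_system nat,
    [/\ UltraFilter U,
        ~ P_point U &
        ~ completely_baire (set_type (in_cantor U))].
Proof.
have [U [UU FU]] := ultraFilterLemma fubini_filter.
exists U; split => //; first exact: ultrafilter_fubini_not_P_point.
exact: ultrafilter_fubini_not_completely_baire.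
Qed.
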